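(* Let $\mathbb{F}_q$ be a finite field with $q$ elements and let $a(T),b(T)\in\mathbb{F}_q[T]$ be nonconstant monic polynomials. Fix any power $q^k$ of $q$ (with $k\ge 1$ an integer) and any congruence class $n_0\in\mathbb{Z}/q^k\mathbb{Z}$. Then there is a constant $c=c(a,b,q^k)>0$, depending only on $a$, $b$ and $q^k$, such that $$\deg\bigl(\gcd(a(T)^n-1,\,b(T)^n-1)\bigr)\ \ge\ c\,n$$ for infinitely many positive integers $n$ satisfying $n\equiv n_0 \pmod{q^k}$.
   Context: The gcd is taken in the polynomial ring $\mathbb{F}_q[T]$, and $\deg$ denotes the degree in $T$. *)

(* Defs.v *)
From HB Require Import structures.
From mathcomp Require Import all_boot all_order all_algebra.

Set Implicit Arguments.
Unset Strict Implicit.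
Unset Printing Implicit Defensive.

(* Main.v *)
Require Import Defs.
From HB Require Import structures.
From mathcomp Require Import all_boot all_order all_algebra.
From mathcomp Require Import finfield.
From mathcomp Require Import classical_sets cardinality reals.

Set Implicit Arguments.
Unset Strict Implicit.
Unset Printing Implicit Defensive.

Import Order.TTheory GRing.Theory Num.Theory.
Local Open Scope classical_set_scope.
Local Open Scope ring_scope.

(** Put [Q = q ^ N] and [n = (Q - 1) * m].  Since [p(X) ^ Q = p(X ^ Q)] for
    every [p] over [F_q], the polynomial [X ^ Q - X] divides [p ^ Q - p], hence
    [p * (p ^ n - 1)].  Thus it divides [a * b * gcd (a ^ n - 1) (b ^ n - 1)],
    so the gcd has degree at least [Q - deg a - deg b], which is linear in [n]
    as long as [m] is bounded.  For [N >= k], moreover, [n] is congruent to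
    [- m] modulo [q ^ k], so a suitable [m] in [1 .. q ^ k] reaches any
    residue class. *)

Lemma expf_card_exp (F : finFieldType) (N : nat) (x : F) :
  x ^+ (#|F| ^ N) = x.
Proof.
by elim: N => [|N IHN]; rewrite ?expr1 // expnS exprM expf_card.
Qed.

Lemma pnat_pchar_card (F : finFieldType) : [pchar F].-nat #|F|.
Proof.
have [p p_pr pcharFp] := finPcharP F.
rewrite (eq_pnat _ (pcharf_eq pcharFp)).
by have := card_pprimeChar pcharFp => /= ->; rewrite pnatX pnat_id.
Qed.

(** Horner induction: with [Q = #|F| ^ N], raising to the power [Q] is additive and fixes constants,
    so passing from [p] to [p * 'X + c] turns the difference into
    [(p ^+ Q - p) * 'X^Q + p * ('X^Q - 'X)]. *)
Lemma dvdp_XnsubX_exp_sub (F : finFieldType) (N : nat) (p : {poly F}) :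
  'X^(#|F| ^ N) - 'X %| p ^+ (#|F| ^ N) - p.
Proof.
elim/poly_ind: p => [|p c IHp].
  by rewrite expr0n expn_eq0 eqn0Ngt (ltnW (finNzRing_gt1 F)) subr0 dvdp0.
rewrite exprDn_pchar; last first.
  by rewrite (eq_pnat _ (pchar_poly F)) pnatX pnat_pchar_card.
rewrite -polyC_exp expf_card_exp exprMn opprD addrACA subrr addr0.
have -> : p ^+ (#|F| ^ N) * 'X^(#|F| ^ N) - p * 'X
        = (p ^+ (#|F| ^ N) - p) * 'X^(#|F| ^ N) + p * ('X^(#|F| ^ N) - 'X).
  by rewrite mulrBl mulrBr addrA subrK.
by rewrite dvdp_add ?dvdp_mulIr ?(dvdp_mulr _ IHp).
Qed.

(** Factor [p ^+ Q - p] as [p * (u - 1)] with [u = p ^+ Q.-1]; then [u - 1] divides [u ^+ m - 1]. *)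
Lemma dvdp_XnsubX_mul_exp_sub1 (F : finFieldType) (N m : nat) (p : {poly F}) :
  'X^(#|F| ^ N) - 'X %| p * (p ^+ ((#|F| ^ N).-1 * m) - 1).
Proof.
apply: dvdp_trans (dvdp_XnsubX_exp_sub N p) _.
have QN0 : (0 < #|F| ^ N)%N by rewrite expn_gt0 (ltnW (finNzRing_gt1 F)).
have -> : p ^+ (#|F| ^ N) - p = p * (p ^+ (#|F| ^ N).-1 - 1).
  by rewrite mulrBr mulr1 -exprS prednK.
rewrite exprM; move: (p ^+ _) => u.
by rewrite (subrX1 u m) mulrA dvdp_mulIl.
Qed.

Lemma exp_sub1_neq0 (R : idomainType) (p : {poly R}) (n : nat) :
  (0 < (size p).-1)%N -> (0 < n)%N -> p ^+ n - 1 != 0.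
Proof.
move=> p_gt0 n_gt0; rewrite subr_eq0; apply/eqP => pn1.
have := size_exp p n; rewrite pn1 size_poly1 => /esym/eqP.
by rewrite muln_eq0 !eqn0Ngt p_gt0 n_gt0.
Qed.

Lemma degree_gcdp_exp_sub1_ge (F : finFieldType) (a b : {poly F}) (N m : nat) :
  (0 < (size a).-1)%N -> (0 < (size b).-1)%N ->
  (0 < N)%N -> (0 < m)%N ->
  (#|F| ^ N <= (size a).-1 + (size b).-1
               + (size (gcdp (a ^+ ((#|F| ^ N).-1 * m) - 1)
                             (b ^+ ((#|F| ^ N).-1 * m) - 1))).-1)%N.
Proof.
move=> a_gt0 b_gt0 N_gt0 m_gt0; set n := ((#|F| ^ N).-1 * m)%N.
have Q_gt1 : (1 < #|F| ^ N)%N.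
  by rewrite -(exp1n N) ltn_exp2r ?finNzRing_gt1.
have n_gt0 : (0 < n)%N by rewrite muln_gt0 m_gt0 andbT -ltnS prednK // ltnW.
have a0 : a != 0 by apply: contraTneq a_gt0 => ->; rewrite size_poly0.
have b0 : b != 0 by apply: contraTneq b_gt0 => ->; rewrite size_poly0.
set g := gcdp _ _.
have g0 : g != 0 by rewrite gcdp_eq0 negb_and exp_sub1_neq0.
have ab0 : a * b != 0 by rewrite mulf_neq0.
have dvd_g : 'X^(#|F| ^ N) - 'X %| a * b * g.
  (* Up to a unit, [a * b * g] is the gcd of the two products by [a * b], so each can be treated
     separately. *)
  rewrite (eqp_dvdr _ (mulp_gcdr _ _ _)) dvdp_gcd.
  apply/andP; split.
    by rewrite mulrAC dvdp_mulr // dvdp_XnsubX_mul_exp_sub1.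
  by rewrite -mulrA dvdp_mull // dvdp_XnsubX_mul_exp_sub1.
have := dvdp_leq (mulf_neq0 ab0 g0) dvd_g.
rewrite size_polyDl ?size_polyN ?size_polyXn ?size_polyX ?ltnS //.
rewrite !size_mul //; rewrite -size_poly_gt0 in g0.
rewrite -size_poly_gt0 in a0; rewrite -size_poly_gt0 in b0.
case: (size a) (size b) (size g) a0 b0 g0 => [|i] [|j] [|l] //= _ _ _.
by rewrite !(addnS, addSn) /= ltnS.
Qed.

Lemma infinite_nat_unbounded (A : set nat) :
  (forall M : nat, exists2 n, A n & (M <= n)%N) -> infinite_set A.
Proof.
move=> A_unbounded /finite_seqP[s As].
have [n An] := A_unbounded (\max_(i <- s) i).+1.
by rewrite ltnNge (@leq_bigmax_seq _ s predT id n) //; move: An; rewrite As.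
Qed.

Theorem theorem4 (R : realType) (F : finFieldType) (a b : {poly F})
    (a_monic : a \is monic) (b_monic : b \is monic)
    (a_nonconst : (0 < (size a).-1)%N) (b_nonconst : (0 < (size b).-1)%N)
    (k : nat) (k_ge1 : (1 <= k)%N) :
  exists c : R, 0 < c /\
    forall n0 : 'Z_(#|F| ^ k),
      infinite_set [set n : nat |
        [/\ (0 < n)%N,
            n%:R = n0 &
            c * n%:R <= (size (gcdp (a ^+ n - 1) (b ^+ n - 1))).-1%:R]].
Proof.
have q_gt1 := finNzRing_gt1 F.
have expq_gt1 j : (0 < j)%N -> (1 < #|F| ^ j)%N.
  by move=> j_gt0; rewrite -(exp1n j) ltn_exp2r.
have qk_gt1 := expq_gt1 _ k_ge1.
have qk_gt0 : 0 < (#|F| ^ k)%:R :> R by rewrite ltr0n ltnW.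
(* The factor [#|F| ^ k] pays for [m], the factor 2 for the loss of [deg a + deg b]. *)
exists (2 * (#|F| ^ k)%:R)^-1; split; first by rewrite invr_gt0 mulr_gt0.
move=> n0; apply: infinite_nat_unbounded => M.
pose d := ((size a).-1 + (size b).-1)%N.
(* Since [N < #|F| ^ N], the three summands ensure in turn that [#|F| ^ k] divides [#|F| ^ N], that
   [n >= M], and that [2 * d <= #|F| ^ N]. *)
pose N := (k + M + d * 2)%N.
(* A representative of [- n0] that stays positive when [n0 = 0]. *)
pose m := (#|F| ^ k - n0)%N.
have n0_lt : (n0 < #|F| ^ k)%N by rewrite -[X in (_ < X)%N]Zp_cast.
have m_gt0 : (0 < m)%N by rewrite subn_gt0.
have N_gt0 : (0 < N)%N by rewrite /N -addnA addn_gt0 k_ge1.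
have N_lt : (N < #|F| ^ N)%N by exact: ltn_expl.
have Q_gt1 := expq_gt1 _ N_gt0.
have le_m : (m <= #|F| ^ k)%N by exact: leq_subr.
exists ((#|F| ^ N).-1 * m)%N; last first.
  apply: leq_trans (leq_pmulr _ m_gt0).
  rewrite -ltnS prednK ?(ltnW Q_gt1) //; apply: leq_ltn_trans N_lt.
  by rewrite /N -addnA addnCA leq_addr.
split.
- by rewrite muln_gt0 m_gt0 andbT -ltnS prednK // ltnW.
- rewrite natrM natrB 1?ltnW // pchar_Zp // sub0r -subn1 natrB 1?ltnW //.
  (* Modulo [#|F| ^ k] the product becomes [(-1) * (- n0)]. *)
  rewrite /N -addnA expnD natrM pchar_Zp // mul0r sub0r mulrNN mul1r.
  exact: natr_Zp.
have := degree_gcdp_exp_sub1_ge a_nonconst b_nonconst N_gt0 m_gt0.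
rewrite -/d; set g := (size (gcdp _ _)).-1 => Q_le.
have dQ : (d * 2 <= #|F| ^ N)%N.
  by apply: leq_trans (ltnW N_lt); rewrite /N leq_addl.
rewrite ler_pdivrMl ?mulr_gt0 //.
have n_le : ((#|F| ^ N).-1 * m <= #|F| ^ k * #|F| ^ N)%N.
  by rewrite mulnC leq_mul // leq_pred.
(* Doubling [Q <= d + g] and using [2 * d <= Q] gives [2 * Q <= Q + 2 * g]. *)
have Q_le2 : (#|F| ^ N <= 2 * g)%N.
  rewrite -(leq_add2l (#|F| ^ N)) addnn -mul2n.
  apply: leq_trans (leq_mul (leqnn 2) Q_le) _.
  by rewrite mulnDr leq_add2r mulnC.
rewrite -!natrM ler_nat; apply: leq_trans n_le _.
by rewrite (mulnC 2) -mulnA leq_mul2l Q_le2 orbT.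
Qed.
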